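(* Let $\sigma=\sigma^\infty$, with $\sigma^\infty$ the asymptotic restriction defined in the context. Assume that the restricted problem $\mathrm{LP}(\sigma^\infty)$ is feasible and that its optimal solution, denoted $(z_1^\star,\ldots,z_N^\star)$, is unique. Assume moreover that Slater's condition holds for $\sigma=\sigma^\infty$ with $\sigma^\infty>0$: there exists $(\hat z_1,\ldots,\hat z_N)$ with $\hat z_i\in\mathrm{conv}(X_i)$ for all $i$ such that $$\zeta:=\min_{s\in\{1,\ldots,S\}}\Big[b-\sigma^\infty-\sum_{i=1}^N A_i\hat z_i\Big]_s>0,$$ and let $J^{\mathrm{SL}}:=\sum_{i=1}^N c_i^\top\hat z_i$. Let $(y_1^\star,\ldots,y_N^\star)$ be an optimal solution of the master problem $\mathrm{Master}(\sigma^\infty)$ and let each $x_i^\infty$ be an optimal solution of the lexicographic problem $\mathrm{Lex}_i(y_i^\star)$. Let $I_{\mathbb{R}}$ be the set of indices $i\in\{1,\dots,N\}$ such that $z_i^\star\notin X_i$ (for which $|I_{\mathbb{R}}|\le S$). Then $\sum_{i=1}^N c_i^\top x_i^\infty-J^{\mathrm{MILP}}\le B'$, where $J^{\mathrm{MILP}}$ is the optimal cost of the target MILP and $$B':=\sum_{i\in I_{\mathbb{R}}}\big(c_i^\top x_i^\infty-c_i^\top z_i^\star\big)+\frac{\|\sigma^\infty\|_\infty}{\zeta}\Big(J^{\mathrm{SL}}-\sum_{i=1}^N c_i^\top z_i^\star\Big).$$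
   Context: Setting. There are $N$ agents and $S$ linear coupling constraints (the regime of interest is $N\gg S$; no quantitative relation is imposed). For each $i\in\{1,\ldots,N\}$: $X_i=P_i\cap(\mathbb{Z}^{p_i}\times\mathbb{R}^{q_i})$ with $P_i\subset\mathbb{R}^{p_i+q_i}$ a nonempty compact polyhedron, $c_i\in\mathbb{R}^{p_i+q_i}$, $A_i\in\mathbb{R}^{S\times(p_i+q_i)}$; and $b\in\mathbb{R}^S$. The target MILP is: minimize $\sum_{i=1}^N c_i^\top x_i$ subject to $\sum_{i=1}^N A_ix_i\le b$ and $x_i\in X_i$ for all $i$; it is assumed feasible. Vector inequalities are componentwise, $\max$ and $\min$ of vectors are componentwise, $[\cdot]_s$ is the $s$-th component, $\mathbf{1}$ is the vector of ones, and $\mathrm{conv}(X_i)$ is the convex hull of $X_i$. Restricted problem $\mathrm{LP}(\sigma)$, for $\sigma\in\mathbb{R}^S$, $\sigma\ge0$: minimize $\sum_{i=1}^N c_i^\top z_i$ over $z_1,\dots,z_N$ subject to $\sum_{i=1}^N A_iz_i\le b-\sigma$ and $z_i\in\mathrm{conv}(X_i)$ for all $i$. Master problem $\mathrm{Master}(\sigma)$: minimize $\sum_{i=1}^N \pi_i(y_i)$ over $y_1,\dots,y_N\in\mathbb{R}^S$ subject to $\sum_{i=1}^N y_i=b-\sigma$ and $y_i\in Y_i$ for all $i$, where $\pi_i(y_i)=\min\{c_i^\top z_i : A_iz_i\le y_i,\ z_i\in\mathrm{conv}(X_i)\}$ and $Y_i$ is the set of $y_i\in\mathbb{R}^S$ for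 which this minimization is feasible. Lexicographic problem $\mathrm{Lex}_i(y_i)$: minimize lexicographically $\rho_i$, then $\xi_i$, over $(\rho_i,\xi_i,x_i)$ subject to $c_i^\top x_i\le\xi_i$, $A_ix_i\le y_i+\rho_i\mathbf{1}$, $x_i\in X_i$, $\rho_i\ge0$. Equivalently: first let $\bar\rho_i$ be the minimum of $\rho_i\ge 0$ such that some $x_i\in X_i$ satisfies $A_ix_i\le y_i+\rho_i\mathbf{1}$; then $x_i$ is a minimizer of $c_i^\top x_i$ over $x_i\in X_i$ with $A_ix_i\le y_i+\bar\rho_i\mathbf{1}$. Asymptotic restriction: let $L_i=\min_{x_i\in X_i}A_ix_i\in\mathbb{R}^S$ (componentwise), $\rho_i^{\max}=\min_{x_i\in X_i}\max_{s\in\{1,\ldots,S\}}[A_ix_i-L_i]_s$, $\sigma_i^{\mathrm{loc}}=\min\{\rho_i^{\max}\mathbf{1},\ \max_{x_i\in X_i}(A_ix_i-L_i)\}\in\mathbb{R}^S$ (componentwise), and $\sigma^\infty=S\cdot\max_{i\in\{1,\ldots,N\}}\sigma_i^{\mathrm{loc}}\in\mathbb{R}^S$ (componentwise). *)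

(* Defs.v *)
(* MathComp-Analysis *)
From HB Require Import structures.
From mathcomp Require Export all_boot all_order all_algebra.
From mathcomp Require Export all_classical all_reals.
From mathcomp Require Export topology normedtype convex.

Import Order.TTheory GRing.Theory Num.Theory.
Import numFieldNormedType.Exports.

Local Open Scope classical_set_scope.
Local Open Scope ring_scope.

(* In every use below the set is nonempty and the extremum is attained (a
   linear or continuous objective on a compact set, or a finite set), so that
   the infimum and the supremum are a minimum and a maximum. *)
Definition minval {R : realType} {T : Type} (D : set T) (f : T -> R) : R :=
  inf (f @` D).
Definition maxval {R : realType} {T : Type} (D : set T) (f : T -> R) : R :=
  sup (f @` D).

Definition is_minimizer {R : realType} {T : Type}
    (D : set T) (f : T -> R) (x : T) : Prop :=
  D x /\ forall x', D x' -> f x <= f x'.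

Definition lev {R : realType} {n : nat} (u v : 'cV[R]_n) : Prop :=
  forall s, u s 0 <= v s 0.
Definition ltv {R : realType} {n : nat} (u v : 'cV[R]_n) : Prop :=
  forall s, u s 0 < v s 0.

Definition dotp {R : realType} {n : nat} (u v : 'cV[R]_n) : R :=
  (u^T *m v) 0 0.

Definition polyhedron {R : realType} {n : nat} (P : set 'cV[R]_n) : Prop :=
  exists (m : nat) (D : 'M[R]_(m, n)) (d : 'cV[R]_m),
    P = [set x | lev (D *m x) d].

Definition conv_hull {R : realType} {n : nat} (X : set 'cV[R]_n) :
    set 'cV[R]_n :=
  smallest (@convex_set R 'cV[R]_n) X.

(* The first int_dim i = p_i coordinates of the decision vector of agent i are
   the integer ones, the last cont_dim i = q_i are the continuous ones. *)
Record problem (R : realType) (N S : nat) := Problem {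
  int_dim : 'I_N -> nat ;
  cont_dim : 'I_N -> nat ;
  poly : forall i, set 'cV[R]_(int_dim i + cont_dim i) ;
  obj : forall i, 'cV[R]_(int_dim i + cont_dim i) ;
  coupling : forall i, 'M[R]_(S, int_dim i + cont_dim i) ;
  rhs : 'cV[R]_S }.

Arguments int_dim {R N S} _ _.
Arguments cont_dim {R N S} _ _.
Arguments poly {R N S} _ _.
Arguments obj {R N S} _ _.
Arguments coupling {R N S} _ _.
Arguments rhs {R N S} _.

Section Problem.
Context {R : realType} {N S : nat}.
Variable m : problem R N S.

Definition vec (i : 'I_N) : Type := 'cV[R]_(int_dim m i + cont_dim m i).

Definition point : Type := forall i : 'I_N, vec i.

Definition Xset (i : 'I_N) : set (vec i) :=
  [set x : vec i | poly m i x /\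
    forall k : 'I_(int_dim m i), x (lshift (cont_dim m i) k) 0 \is a Num.int].

Definition convX (i : 'I_N) : set (vec i) := conv_hull (Xset i).

Definition cost (x : point) : R := \sum_i dotp (obj m i) (x i).

Definition usage (x : point) : 'cV[R]_S := \sum_i coupling m i *m x i.

Definition milp_feasible : set point :=
  [set x | lev (usage x) (rhs m) /\ forall i, Xset i (x i)].

Definition J_milp : R := minval milp_feasible cost.

Definition lp_feasible (sigma : 'cV[R]_S) : set point :=
  [set z | lev (usage z) (rhs m - sigma) /\ forall i, convX i (z i)].

Definition lp_optimal (sigma : 'cV[R]_S) (z : point) : Prop :=
  is_minimizer (lp_feasible sigma) cost z.

Definition local_feasible (i : 'I_N) (y : 'cV[R]_S) : set (vec i) :=
  [set z : vec i | lev (coupling m i *m z) y /\ convX i z].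

Definition Yset (i : 'I_N) : set 'cV[R]_S :=
  [set y | local_feasible i y !=set0].

Definition local_cost (i : 'I_N) (y : 'cV[R]_S) : R :=
  minval (local_feasible i y) (dotp (obj m i)).

Definition master_feasible (sigma : 'cV[R]_S) : set ('I_N -> 'cV[R]_S) :=
  [set y | \sum_i y i = rhs m - sigma /\ forall i, Yset i (y i)].

Definition master_cost (y : 'I_N -> 'cV[R]_S) : R := \sum_i local_cost i (y i).

Definition master_optimal (sigma : 'cV[R]_S) (y : 'I_N -> 'cV[R]_S) : Prop :=
  is_minimizer (master_feasible sigma) master_cost y.

Definition lex_feasible (i : 'I_N) (y : 'cV[R]_S)
    (rho xi : R) (x : vec i) : Prop :=
  [/\ dotp (obj m i) x <= xi,
      lev (coupling m i *m x) (y + const_mx rho),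
      Xset i x & 0 <= rho].

(* R *l R is R * R with the lexicographic order. *)
Definition lex_optimal (i : 'I_N) (y : 'cV[R]_S)
    (rho xi : R) (x : vec i) : Prop :=
  lex_feasible i y rho xi x /\
  forall rho' xi' x', lex_feasible i y rho' xi' x' ->
    ((rho, xi) <= (rho', xi') :> (R *l R))%O.

Definition lower (i : 'I_N) : 'cV[R]_S :=
  \col_s minval (Xset i) (fun x => (coupling m i *m x) s 0).

Definition rho_max (i : 'I_N) : R :=
  minval (Xset i) (fun x =>
    maxval [set: 'I_S] (fun s => (coupling m i *m x - lower i) s 0)).

Definition sigma_loc (i : 'I_N) : 'cV[R]_S :=
  \col_s Num.min (rho_max i)
    (maxval (Xset i) (fun x => (coupling m i *m x - lower i) s 0)).

Definition sigma_inf : 'cV[R]_S :=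
  S%:R *: \col_s maxval [set: 'I_N] (fun i => sigma_loc i s 0).

Definition zeta (zhat : point) : R :=
  minval [set: 'I_S] (fun s => (rhs m - sigma_inf - usage zhat) s 0).

Definition I_R (z : point) : {set 'I_N} := [set i | `[< ~ Xset i (z i) >]].

(* The library norm on 'cV[R]_S is the infinity norm. *)
Definition B' (x z zhat : point) : R :=
  \sum_(i in I_R z) (dotp (obj m i) (x i) - dotp (obj m i) (z i))
  + `|sigma_inf| / zeta zhat * (cost zhat - cost z).

End Problem.

(* Main.v *)
Require Import Defs.
From mathcomp Require Import ring lra.
From mathcomp Require Import interval_inference function_spaces derive.

(** Write z* for the optimal solution of the restricted problem, y* for the
    master allocation, x for the lexicographic solution and sigma for the
    restriction. The suboptimality splits as
    (cost x - cost z* ) + (cost z* - J_milp).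

    Uniqueness of z* controls the first term, in two ways. It makes z* rigid:
    no nonzero direction with zero total resource usage can be followed both
    ways from z* inside the convex hulls ([lp_unique_rigid]). An agent whose
    z*_i is not in X_i can move both ways ([conv_hull_flat]), and more than S
    such agents could combine their moves into one of zero usage, the usages
    being vectors of R^S; hence at most S agents are fractional ([card_I_R]).
    It also identifies the minimizers of the local problems at y* with z*, since
    together they solve the restricted problem at no greater cost than z*; so
    z*_i respects the share y*_i ([master_optimal_usage]). When
    z*_i lies in X_i it is therefore a competitor with zero violation in the
    lexicographic problem, so x_i costs no more than z*_i ([lex_cost_le]), and
    only the fractional agents contribute.

    The local minimizers exist because the convex hull of a compact subset of
    R^n is compact ([compact_conv_hull]): by Caratheodory's reduction
    ([combinationsS]) it is the continuous image of a compact set of weights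
    and points, the number of points being fixed.

    The second term is the price of the restriction. A feasible point of the
    MILP and the Slater point have a convex combination which is feasible for
    the restricted problem, and comparing its cost with that of z* yields the
    sensitivity bound ([slater_bound]). *)

Set Implicit Arguments.
Unset Strict Implicit.
Unset Printing Implicit Defensive.

Import Order.TTheory GRing.Theory Num.Theory.
Import numFieldNormedType.Exports.

Local Open Scope classical_set_scope.
Local Open Scope ring_scope.

(** * Linear dependence *)

(** The coefficients of the dependency are extended by zero outside the index
    set, so that the sum ranges over all of [I]. *)
Lemma exists_lincomb0 {R : fieldType} {I : finType} {n : nat} (A : {set I})
    (v : I -> 'cV[R]_n) : (n < #|A|)%N ->
  exists u : I -> R, [/\ forall i, i \notin A -> u i = 0,
    exists i, u i != 0 & \sum_i u i *: v i = 0].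
Proof.
move=> nA; pose M : 'M[R]_(#|A|, n) := \matrix_(j < #|A|) (v (enum_val j))^T.
have : kermx M != 0.
  rewrite kermx_eq0; apply: contraL nA => /eqP <-.
  by rewrite -leqNgt rank_leq_col.
case/rowV0Pn => k /sub_kermxP kM k0.
pose u i := \sum_(j < #|A| | enum_val j == i) k 0 j.
have uE j : u (enum_val j) = k 0 j.
  rewrite /u (big_pred1 j) // => j' /=.
  by rewrite (inj_eq enum_val_inj).
have u0 i : i \notin A -> u i = 0.
  move=> iA; rewrite /u big1 // => j /eqP ji.
  by move: iA; rewrite -ji enum_valP.
exists u; split => //.
  by case/rV0Pn: k0 => j kj; exists (enum_val j); rewrite uE.
rewrite (bigID [in A]) /= [X in _ + X]big1 ?addr0; last first.
  by move=> i iA; rewrite u0 // scale0r.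
rewrite big_enum_val /=.
apply: trmx_inj; rewrite trmx0 -kM mulmx_sum_row linear_sum /=.
by apply: eq_bigr => j _; rewrite linearZ /= uE rowK.
Qed.

(** * Convex hulls *)

Section ConvexSets.
Context {R : realType} {V : lmodType R}.
Implicit Types (A : set V) (x y : V) (t : R).

Lemma convex_setP A : @convex_set R V A <->
  forall x y t, 0 <= t <= 1 -> A x -> A y -> A (t *: x + (1 - t) *: y).
Proof.
split=> [cA x y t /andP[t0 t1] Ax Ay | cA x y t].
  by have := cA x y (Itv01 t0 t1); rewrite !inE; apply.
rewrite !inE => Ax Ay; apply: cA => //.
by apply/andP; split; [exact: ge0|exact: le1].
Qed.
End ConvexSets.

Section ConvHull.
Context {R : realType} {n : nat}.
Local Notation V := 'cV[R]_n.
Implicit Types (X : set V) (x y : V) (t : R).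

Lemma sub_conv_hull X : X `<=` conv_hull X.
Proof. exact: sub_gen_smallest. Qed.

Lemma conv_hull_sub X (Y : set V) :
  @convex_set R V Y -> X `<=` Y -> conv_hull X `<=` Y.
Proof. exact: smallest_sub. Qed.

Lemma convex_conv_hull X : @convex_set R V (conv_hull X).
Proof.
apply/convex_setP => x y t t01 Xx Xy A [cA XA].
by move/convex_setP: (cA); apply => //; [apply: Xx | apply: Xy].
Qed.

Lemma conv_hullD X x y t : 0 <= t <= 1 -> conv_hull X x -> conv_hull X y ->
  conv_hull X (t *: x + (1 - t) *: y).
Proof. by move: x y t; apply/convex_setP/convex_conv_hull. Qed.

(** The points of the hull which lie in [X] or are the midpoint of a nontrivial
    segment of the hull form a convex set containing [X], hence the whole
    hull. *)
Lemma conv_hull_flat X z : conv_hull X z -> ~ X z ->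
  exists d, [/\ d != 0, conv_hull X (z + d) & conv_hull X (z - d)].
Proof.
pose E := [set w | conv_hull X w /\
  (X w \/ exists d, [/\ d != 0, conv_hull X (w + d) & conv_hull X (w - d)])].
suff XE : conv_hull X `<=` E by move=> /XE[_ []].
apply: conv_hull_sub; last by move=> x Xx; split; [exact: sub_conv_hull|left].
apply/convex_setP => x y t t01 Ex Ey.
have [->|xy] := eqVneq x y.
  by rewrite -scalerDl addrC subrK scale1r.
have [->|t0] := eqVneq t 0; first by rewrite scale0r add0r subr0 scale1r.
have [->|t1] := eqVneq t 1; first by rewrite subrr scale0r addr0 scale1r.
split; first by apply: conv_hullD => //; [case: Ex|case: Ey].
right; case: Ex Ey => Cx _ [Cy _].
case/andP: t01; rewrite !le_eqVlt eq_sym (negbTE t0) (negbTE t1) /=.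
move=> {}t0 {}t1.
(* The distance from t to the nearer endpoint of [0, 1] is how far the parameter
   can move both ways. *)
pose e := Num.min t (1 - t).
have e0 : 0 < e by rewrite lt_min t0 subr_gt0.
have et : e <= t by rewrite ge_min lexx.
have et' : e <= 1 - t by rewrite ge_min lexx orbT.
exists (e *: (x - y)); split.
- by rewrite scaler_eq0 subr_eq0 negb_or gt_eqF.
- have -> : t *: x + (1 - t) *: y + e *: (x - y) =
            (t + e) *: x + (1 - (t + e)) *: y.
    by apply/matrixP => i j; rewrite !mxE; ring.
  by apply: conv_hullD => //; lra.
- have -> : t *: x + (1 - t) *: y - e *: (x - y) =
            (t - e) *: x + (1 - (t - e)) *: y.
    by apply/matrixP => i j; rewrite !mxE; ring.
  by apply: conv_hullD => //; lra.
Qed.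

(** Fixing the number [K] of points, repetitions allowed, lets the weights and
    the points range over a compact space when [X] is compact. *)
Definition combinations X (K : nat) : set V :=
  [set z | exists w : 'I_K -> R, exists x : 'I_K -> V,
     [/\ forall i, 0 <= w i, \sum_i w i = 1, forall i, X (x i) &
         z = \sum_i w i *: x i]].

(** Caratheodory's reduction: with at least n + 2 points, the vectors (x_i, 1)
    are dependent, and the weights can be moved along the dependency until one
    of them vanishes, which leaves their sum and the combination unchanged. *)
Lemma combinationsS X K : (n.+1 <= K)%N ->
  combinations X K.+1 `<=` combinations X K.
Proof.
move=> nK z [w [x [w0 w1 Xx ->]]].
have [|u [_ [j uj]]] := @exists_lincomb0 R _ _ [set: 'I_K.+1]%SET
  (fun i => col_mx (x i) (1 : 'cV[R]_1)).
  by rewrite cardsT card_ord addn1.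
under eq_bigr do rewrite scale_col_mx.
move=> ux.
have ux0 : \sum_i u i *: x i = 0.
  have := congr1 usubmx ux; rewrite linear_sum linear0 => uxE.
  by rewrite -[RHS]uxE; apply: eq_bigr => i _; rewrite /= col_mxKu.
have u0 : \sum_i u i = 0.
  have := congr1 (fun M => dsubmx M 0 0) ux.
  rewrite linear_sum summxE linear0 mxE => uE.
  by rewrite -[RHS]uE; apply: eq_bigr => i _; rewrite /= col_mxKd !mxE mulr1.
have [i0 ui0] : exists i, 0 < u i.
  apply: contrapT => /forallNP un; suff : u j = 0 by apply/eqP.
  have un' i : u i <= 0 by rewrite leNgt; apply/negP.
  have Nu0 : \sum_i - u i = 0 by rewrite sumrN u0 oppr0.
  apply/eqP; rewrite -oppr_eq0; apply/eqP.
  by apply: (psumr_eq0P _ Nu0) => // i _; rewrite oppr_ge0.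
case: (@arg_minP _ _ _ i0 [pred i | 0 < u i] (fun i => w i / u i) ui0)
  => /= k uk kmin.
(* t is the largest step along -u that keeps all the weights nonnegative; the
   weight of k reaches 0. *)
pose t := w k / u k.
have t0 : 0 <= t by rewrite divr_ge0 // ltW.
have wk : w k - t * u k = 0 by rewrite divfK ?subrr // gt_eqF.
exists (fun i => w (lift k i) - t * u (lift k i)), (fun i => x (lift k i)).
split => // [i||].
- have [ui|ui] := ltP 0 (u (lift k i)).
    by rewrite subr_ge0 -ler_pdivlMr //; apply: kmin.
  by rewrite subr_ge0 (le_trans _ (w0 _)) // mulr_ge0_le0.
- have : \sum_i (w i - t * u i) = 1.
    by rewrite sumrB w1 -mulr_sumr u0 mulr0 subr0.
  by rewrite (bigD1_ord k) //= wk add0r.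
- have <- : \sum_i (w i - t * u i) *: x i = \sum_i w i *: x i.
    under eq_bigr do rewrite scalerBl -scalerA.
    by rewrite sumrB -scaler_sumr ux0 scaler0 subr0.
  by rewrite (bigD1_ord k) //= wk scale0r add0r.
Qed.

Lemma combinations_sub X K L : (n.+1 <= L)%N -> (L <= K)%N ->
  combinations X K `<=` combinations X L.
Proof.
move=> nL; elim: K => [|K IH]; first by rewrite leqn0 => /eqP ->.
rewrite leq_eqVlt => /orP[/eqP ->//|LK].
by apply: subset_trans (IH LK); apply: combinationsS; exact: leq_trans nL LK.
Qed.

(** The combinations of n + 1 points are convex: two of them form one
    combination of 2 (n + 1) points, which the reduction brings back to
    n + 1. *)
Lemma conv_hull_combinations X : conv_hull X = combinations X n.+1.
Proof.
apply/seteqP; split; last first.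
  suff H K : combinations X K.+1 `<=` conv_hull X by exact: H.
  elim: K => [|K IH] z [w [x [w0 w1 Xx ->]]].
    move: w1; rewrite !big_ord1 => ->; rewrite scale1r.
    exact: sub_conv_hull.
  pose s := \sum_(i < K.+1) w (lift ord0 i).
  rewrite big_ord_recl; rewrite big_ord_recl -/s in w1.
  have s0 : 0 <= s by apply: sumr_ge0.
  (* If s = 0 the remaining weights cannot be renormalized, but they vanish. *)
  have [s00|sn0] := eqVneq s 0.
    move: w1; rewrite s00 addr0 => ->.
    rewrite [X in _ + X]big1 ?addr0 ?scale1r; first exact: sub_conv_hull.
    by move=> i _; rewrite (psumr_eq0P _ s00) ?scale0r.
  have -> : \sum_(i < K.+1) w (lift ord0 i) *: x (lift ord0 i) =
     (1 - w ord0) *: \sum_(i < K.+1) (w (lift ord0 i) / s) *: x (lift ord0 i).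
    rewrite scaler_sumr; apply: eq_bigr => i _; rewrite scalerA.
    by rewrite -w1 [w ord0 + _]addrC addrK mulrC divfK.
  apply: conv_hullD; first by rewrite w0 -w1 lerDl.
    exact: sub_conv_hull.
  apply: IH; exists (fun i => w (lift ord0 i) / s), (fun i => x (lift ord0 i)).
  by split => // [i|]; [rewrite divr_ge0|rewrite -mulr_suml divff].
apply: conv_hull_sub; last first.
  move=> x Xx; apply: (@combinations_sub X n.+1) => //.
  exists (fun i => (i == 0)%:R), (fun=> x); split => //.
  - by rewrite (bigD1 ord0) //= big1 ?addr0 // => i /negbTE ->.
  - rewrite (bigD1 ord0) //= big1 ?scale1r ?addr0 // => i /negbTE ->.
    exact: scale0r.
apply/convex_setP => _ _ t t01 [w [x [w0 w1 Xx ->]]] [v [y [v0 v1 Yy ->]]].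
apply: (@combinations_sub X (n.+1 + n.+1)) => //; first exact: leq_addr.
exists (fun i : 'I_(n.+1 + n.+1) =>
  match fintype.split i with inl j => t * w j | inr j => (1 - t) * v j end).
exists (fun i : 'I_(n.+1 + n.+1) =>
  match fintype.split i with inl j => x j | inr j => y j end).
case/andP: t01 => t0 t1.
split.
- by move=> i; case: fintype.split => j; rewrite mulr_ge0 ?subr_ge0.
- rewrite big_split_ord /=.
  under eq_bigr do rewrite (unsplitK (inl _)).
  under [X in _ + X]eq_bigr do rewrite (unsplitK (inr _)).
  by rewrite -!mulr_sumr w1 v1 !mulr1 addrC subrK.
- by move=> i; case: fintype.split.
- rewrite big_split_ord /=.
  under [X in _ = X + _]eq_bigr do rewrite (unsplitK (inl _)) -scalerA.
  under [X in _ = _ + X]eq_bigr do rewrite (unsplitK (inr _)) -scalerA.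
  by rewrite -!scaler_sumr.
Qed.

End ConvHull.

(** * Compactness *)

Section Compactness.
Context {R : realType} {n : nat}.
Local Notation V := 'cV[R]_n.

(** The combinations are the image of a closed subset of ([0, 1] x X)^K, which
    is compact by Tychonoff's theorem. *)
Lemma compact_combinations (X : set V) K :
  compact X -> compact (combinations X K).
Proof.
move=> cX; pose T := fun _ : 'I_K => (R^o * V)%type.
pose D : set (prod_topology T) :=
  [set f | forall i, (`[0, 1]%classic `*` X) (f i)].
pose wt (f : prod_topology T) : R := \sum_i (f i).1.
pose F (f : prod_topology T) : V := \sum_i (f i).1 *: (f i).2.
have cD : compact D.
  apply: (@tychonoff 'I_K T (fun=> `[0, 1]%classic `*` X)) => i.
  by apply: compact_setX => //; exact: segment_compact.
have c1 i : continuous (fun f : prod_topology T => (f i).1).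
  move=> f; apply: (@cvg_comp _ _ _ (fun f : prod_topology T => f i) fst).
    exact: (@proj_continuous _ T i).
  exact: cvg_fst.
have c2 i : continuous (fun f : prod_topology T => (f i).2).
  move=> f; apply: (@cvg_comp _ _ _ (fun f : prod_topology T => f i) snd).
    exact: (@proj_continuous _ T i).
  exact: cvg_snd.
have cwt : continuous wt.
  apply: (@continuous_big R^o) => [|i _]; last exact: c1.
  exact: add_continuous.
have cF : continuous F.
  apply: (@continuous_big V) => [|i _]; first exact: add_continuous.
  move=> f; exact: (cvgZ (c1 i f) (c2 i f)).
have -> : combinations X K = F @` (D `&` wt @^-1` [set 1]).
  apply/seteqP; split => [z [w [x [w0 w1 Xx ->]]]|_ [f [Df wf] <-]].
    exists (fun i => (w i, x i)) => //; split => // i; split => //=.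
    rewrite in_itv /= w0 -w1 (bigD1 i) //= lerDl; exact: sumr_ge0.
  exists (fun i => (f i).1), (fun i => (f i).2); split => // i.
    by have [/=] := Df i; rewrite in_itv => /andP[].
  by have [] := Df i.
apply: continuous_compact; first exact: continuous_subspaceT.
apply: compact_closedI => //; apply: preimage_closed => [f _|].
  exact: cwt.
exact: closed_eq.
Qed.

Lemma compact_conv_hull (X : set V) : compact X -> compact (conv_hull X).
Proof. by rewrite conv_hull_combinations; exact: compact_combinations. Qed.

Lemma continuous_mulmx p (A : 'M[R]_(p, n)) s :
  continuous (fun x : V => (A *m x) s 0).
Proof.
have -> : (fun x : V => (A *m x) s 0) = (fun x => \sum_j A s j * x j 0).
  by apply/funext => x; rewrite mxE.
apply: (@continuous_big R^o) => [|j _]; first exact: add_continuous.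
by move=> x; exact: (cvgM (cvg_cst (A s j)) (@coord_continuous R n 1 j 0 x)).
Qed.

Lemma closed_lev p (A : 'M[R]_(p, n)) (b : 'cV[R]_p) :
  closed [set x : V | lev (A *m x) b].
Proof.
have -> : [set x : V | lev (A *m x) b] =
    \bigcap_s (fun x : V => (A *m x) s 0) @^-1` [set r | r <= b s 0].
  by apply/seteqP; split => [x Ax s _|x Ax s]; [exact: Ax|exact: (Ax s I)].
apply: closed_bigI => s _; apply: preimage_closed => [x _|].
  exact: continuous_mulmx.
exact: closed_le.
Qed.
End Compactness.

Lemma closed_int {R : realType} : closed [set x : R | x \is a Num.int].
Proof.
move=> x clx; apply: contrapT => xint.
have xfl : (Num.floor x)%:~R < x < (Num.floor x + 1)%:~R.
  rewrite floorD1_gt lt_neqAle floor_le_tmp !andbT.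
  by apply: contra_notN xint => /eqP <-; exact: intr_int.
have /clx[_ /= [/intrP[k ->]]] :
    nbhs x `](Num.floor x)%:~R, (Num.floor x + 1)%:~R[%classic.
  by apply: open_nbhs_nbhs; split; [exact: interval_open|rewrite /= in_itv].
by rewrite /= in_itv /= !ltr_int ltzD1 ltNge => /andP[/negP].
Qed.

(** * Attained minima *)

Lemma minval_eq {R : realType} {T : Type} (D : set T) (f : T -> R) x :
  is_minimizer D f x -> minval D f = f x.
Proof.
move=> [Dx fx]; apply/eqP; rewrite eq_le; apply/andP; split.
  by apply: ge_inf; [exists (f x) => _ [y Dy <-]; exact: fx|exists x].
by apply: lb_le_inf => [|_ [y Dy <-]]; [exists (f x), x|exact: fx].
Qed.

Lemma finite_minimizer {R : realType} {I : finType} (i0 : I) (f : I -> R) :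
  exists i, is_minimizer [set: I] f i.
Proof.
case: (@arg_minP _ _ _ i0 xpredT f isT) => i _ fi.
by exists i; split => // j _; exact: fi.
Qed.

(** * Linear programs over the agents *)

Section Problem.
Context {R : realType} {N S : nat} (m : problem R N S).
Implicit Types (x y z : point m) (sigma : 'cV[R]_S).

Lemma dotp_lincomb n (c u v : 'cV[R]_n) a b :
  dotp c (a *: u + b *: v) = a * dotp c u + b * dotp c v.
Proof. by rewrite /dotp mulmxDr -!scalemxAr !mxE. Qed.

Lemma cost_lincomb x y a b :
  cost m (fun i => a *: x i + b *: y i) = a * cost m x + b * cost m y.
Proof.
rewrite /cost !mulr_sumr -big_split; apply: eq_bigr => i _.
exact: dotp_lincomb.
Qed.

Lemma usage_lincomb x y a b :
  usage m (fun i => a *: x i + b *: y i) = a *: usage m x + b *: usage m y.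
Proof.
rewrite /usage !scaler_sumr -big_split; apply: eq_bigr => i _.
by rewrite mulmxDr -!scalemxAr.
Qed.

Lemma compact_Xset i : compact (poly m i) -> compact (Xset m i).
Proof.
move=> cP; have -> : Xset m i = poly m i `&`
    \bigcap_k (fun x : vec m i => x (lshift (cont_dim m i) k) 0) @^-1`
      [set r | r \is a Num.int].
  apply/seteqP; split => x [Px Zx]; split => // k; first by move=> _; exact: Zx.
  exact: (Zx k I).
apply: compact_closedI => //; apply: closed_bigI => k _.
apply: preimage_closed => [x _|]; last exact: closed_int.
exact: coord_continuous.
Qed.

Lemma local_minimizer i (b : 'cV[R]_S) : compact (Xset m i) -> Yset m i b ->
  exists w, is_minimizer (local_feasible m i b) (dotp (obj m i)) w.
Proof.
move=> cX bY.
have cF : compact (local_feasible m i b).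
  rewrite (_ : local_feasible m i b =
    convX m i `&` [set w | lev (coupling m i *m w) b]); last first.
    by apply/seteqP; split => w [].
  by apply: compact_closedI; [exact: compact_conv_hull|exact: closed_lev].
have [w] := compact_EVT_min bY cF
  (continuous_subspaceT (@continuous_mulmx R _ 1 (obj m i)^T 0)).
rewrite inE => wF wmin; exists w; split => // w' w'F.
by apply: wmin; rewrite inE.
Qed.

(** Both z + e and z - e have the usage of z, hence are feasible, and their
    costs average to that of z, hence they are optimal. *)
Lemma lp_unique_rigid sigma z (e : point m) : lp_optimal m sigma z ->
  (forall z', lp_optimal m sigma z' -> z' = z) -> usage m e = 0 ->
  (forall i, convX m i (z i + e i)) -> (forall i, convX m i (z i - e i)) ->
  forall i, e i = 0.
Proof.
move=> [[uz Cz] zmin] zuniq ue Cp Cm i.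
pose ze (t : R) : point m := fun i => 1 *: z i + t *: e i.
have zeF t :
    (forall i, convX m i (z i + t *: e i)) -> lp_feasible m sigma (ze t).
  move=> Ct; split => [|j]; last by rewrite /ze scale1r.
  by rewrite usage_lincomb ue scaler0 addr0 scale1r.
have Fp : lp_feasible m sigma (ze 1) by apply: zeF => j; rewrite scale1r.
have Fm : lp_feasible m sigma (ze (-1)) by apply: zeF => j; rewrite scaleN1r.
have := zmin _ Fp; have := zmin _ Fm; rewrite !cost_lincomb => cm cp.
have /zuniq/(congr1 (fun y : point m => y i)) : lp_optimal m sigma (ze 1).
  split => // y yF; apply: le_trans (zmin _ yF); rewrite cost_lincomb; lra.
by rewrite /ze !scale1r => zei; apply: (addrI (z i)); rewrite zei addr0.
Qed.

(** Fractional agents have two-sided directions d_i; more than S of them admit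
    coefficients, not all zero, that cancel the total usage. *)
Lemma card_I_R sigma z : lp_optimal m sigma z ->
  (forall z', lp_optimal m sigma z' -> z' = z) -> (#|I_R m z| <= S)%N.
Proof.
move=> zopt zuniq; rewrite leqNgt; apply/negP => SI.
have Cz : forall i, convX m i (z i) by case: zopt => -[].
have /(_ _)/cid-/all_sig[d dP] : forall i, exists d : vec m i, i \in I_R m z ->
    [/\ d != 0, convX m i (z i + d) & convX m i (z i - d)].
  move=> i; have [|_] := boolP (i \in I_R m z); last by exists 0.
  rewrite inE => /asboolP /(conv_hull_flat (Cz i))[d dP].
  by exists d.
have [u [u0 [j uj]]] := exists_lincomb0 (fun i => coupling m i *m d i) SI.
have [k [_ kmin]] := finite_minimizer j (fun i => - `|u i|).
have {kmin} kmax i : `|u i| <= `|u k| by rewrite -lerN2; exact: kmin.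
have uk : 0 < `|u k| by apply: lt_le_trans (kmax j); rewrite normr_gt0.
(* Dividing by the largest modulus brings the coefficients into [-1, 1], so that
   z_i + v_i d_i and z_i - v_i d_i lie between z_i - d_i and z_i + d_i. *)
pose v i := u i / `|u k|.
have v1 i : -1 <= v i <= 1.
  by rewrite -ler_norml normrM normfV normr_id ler_pdivrMr ?mul1r.
move=> ud.
have vd : usage m (fun i => v i *: d i) = 0.
  rewrite -[RHS](scaler0 _ `|u k|^-1) -ud scaler_sumr.
  by apply: eq_bigr => i _; rewrite -scalemxAr scalerA mulrC.
have Cv i s : -1 <= s <= 1 -> i \in I_R m z -> convX m i (z i + s *: d i).
  move=> s1 /dP[_ Cp Cm].
  have -> : z i + s *: d i =
      ((1 + s) / 2) *: (z i + d i) + (1 - (1 + s) / 2) *: (z i - d i).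
    by apply/matrixP => a b; rewrite !mxE; field.
  by apply: conv_hullD => //; lra.
have jI : j \in I_R m z by apply: contra_neqT uj => /u0.
have Cve t i : -1 <= t * v i <= 1 -> convX m i (z i + (t * v i) *: d i).
  have [iI|/u0 ui] := boolP (i \in I_R m z); first by move/Cv; exact.
  by rewrite /v ui mul0r mulr0 scale0r addr0.
have /(_ j)/eqP : forall i, v i *: d i = 0.
  apply: (lp_unique_rigid zopt zuniq vd) => i.
    by have := Cve 1 i; rewrite mul1r; apply.
  rewrite -scaleNr -mulN1r; apply: Cve; have := v1 i; lra.
rewrite scaler_eq0 mulf_eq0 invr_eq0 (negbTE uj) gt_eqF //=.
by have [/negbTE ->] := dP j jI.
Qed.

(** The allocation made of the usages of z, with the slack given to one agent,
    is feasible for the master problem. Hence the local minimizers at y, which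
    are feasible for the linear program, cost at most as much as z, and
    uniqueness identifies them with z. *)
Lemma master_optimal_usage (i0 : 'I_N) sigma z (y : 'I_N -> 'cV[R]_S) :
  (forall i, compact (Xset m i)) -> lp_optimal m sigma z ->
  (forall z', lp_optimal m sigma z' -> z' = z) -> master_optimal m sigma y ->
  forall i, lev (coupling m i *m z i) (y i).
Proof.
move=> cX [[uz Cz] zmin] zuniq [[sumy Yy] ymin].
have /(_ _)/cid-/all_sig[w wmin] := fun i => local_minimizer (cX i) (Yy i).
have wF : lp_feasible m sigma w.
  split => [s|i]; last by have [[]] := wmin i.
  rewrite -sumy /usage !summxE; apply: ler_sum => i _.
  by have [[wy _] _] := wmin i; exact: wy.
pose r := rhs m - sigma - usage m z.
pose y' i := coupling m i *m z i + (if i == i0 then r else 0).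
have zy' i : local_feasible m i (y' i) (z i).
  split => // s; rewrite /y' [leRHS]mxE lerDl.
  case: (i == i0); last by rewrite mxE.
  by have := uz s; rewrite !mxE; lra.
have y'F : master_feasible m sigma y'.
  split => [|i]; last by exists (z i).
  by rewrite big_split /= -big_mkcond big_pred1_eq addrC subrK.
have lc i : local_cost m i (y i) = dotp (obj m i) (w i) := minval_eq (wmin i).
have wz : cost m w <= cost m z.
  have := ymin _ y'F; rewrite /master_cost.
  under eq_bigr do rewrite lc.
  move=> /le_trans; apply; apply: ler_sum => i _.
  have [v vmin] := local_minimizer (cX i) (ex_intro _ (z i) (zy' i)).
  by rewrite /local_cost (minval_eq vmin); have [_] := vmin; exact.
have <- : w = z.
  by apply: zuniq; split => // x xF; apply: le_trans (zmin _ xF).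
by move=> i; have [[]] := wmin i.
Qed.

(** The point w shows that no violation is needed, so the first
    objective vanishes at the optimum and the second one compares the costs. *)
Lemma lex_cost_le i (b : 'cV[R]_S) rho xi (v w : vec m i) :
  lex_optimal m i b rho xi v -> Xset m i w -> lev (coupling m i *m w) b ->
  dotp (obj m i) v <= dotp (obj m i) w.
Proof.
move=> [[cv _ _ rho0] vmin] Xw wb.
have wF : lex_feasible m i b 0 (dotp (obj m i) w) w.
  by split => // s; have := wb s; rewrite !mxE addr0.
have := vmin _ _ _ wF; rewrite lexi_pair => /andP[_].
by rewrite -[(0 <= rho)%O]/(0 <= rho) rho0 /=; exact: le_trans.
Qed.

(** The weight t on the Slater point solves t * zeta = (1 - t) * |sigma|: the
    slack of the Slater point then pays, in each constraint, for the restriction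
    that x may violate. *)
Lemma slater_bound (s0 : 'I_S) z x zhat :
  lp_optimal m (sigma_inf m) z ->
  (forall i, convX m i (zhat i)) -> 0 < zeta m zhat -> milp_feasible m x ->
  cost m z - cost m x <=
  `|sigma_inf m| / zeta m zhat * (cost m zhat - cost m z).
Proof.
set sg := sigma_inf m => -[_ zmin] Chat; set ze := zeta m zhat => ze0 [ux Xx].
have zes s : ze <= (rhs m - sg - usage m zhat) s 0.
  have [k kmin] :=
    finite_minimizer s0 (fun s => (rhs m - sg - usage m zhat) s 0).
  by rewrite /ze /zeta (minval_eq kmin); have [_] := kmin; exact.
have sgn s : sg s 0 <= `|sg|.
  apply: le_trans (ler_norm _) _.
  rewrite [leRHS]/Num.norm /= mx_normrE.
  exact: (le_bigmax_cond _ (fun ij : 'I_S * 'I_1 => `|sg ij.1 ij.2|)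
    (j := (s, 0))).
have sgn0 : 0 <= `|sg| by [].
pose t := `|sg| / (ze + `|sg|).
have D0 : 0 < ze + `|sg| by lra.
have t01 : 0 <= t <= 1.
  by rewrite divr_ge0 ?(ltW D0) //= ler_pdivrMr // mul1r; lra.
have tE : t * ze = (1 - t) * `|sg| by rewrite /t; field; rewrite gt_eqF.
pose w : point m := fun i => t *: zhat i + (1 - t) *: x i.
have wF : lp_feasible m sg w.
  split => [s|i]; last exact: (conv_hullD t01 (Chat i) (sub_conv_hull (Xx i))).
  rewrite usage_lincomb; have := zes s; have := ux s; have := sgn s.
  rewrite !mxE; nra.
have := zmin _ wF; rewrite cost_lincomb => zw.
have {zw} : cost m z * (ze + `|sg|) <= `|sg| * cost m zhat + ze * cost m x.
  have -> : `|sg| * cost m zhat + ze * cost m x =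
      (t * cost m zhat + (1 - t) * cost m x) * (ze + `|sg|).
    by rewrite /t; field; rewrite gt_eqF.
  by rewrite ler_pM2r.
rewrite mulrAC ler_pdivlMr //; lra.
Qed.
End Problem.

(** * The suboptimality bound *)

Unset Implicit Arguments.

Theorem mainTheorem4 (R : realType) (N S : nat) (N_gt0 : (0 < N)%N)
    (S_gt0 : (0 < S)%N) (m : problem R N S)
    (poly_polyhedron : forall i, polyhedron (poly m i))
    (poly_nonempty : forall i, poly m i !=set0)
    (poly_compact : forall i, compact (poly m i))
    (milp_is_feasible : milp_feasible m !=set0)
    (lp_is_feasible : lp_feasible m (sigma_inf m) !=set0)
    (zstar : point m)
    (zstar_optimal : lp_optimal m (sigma_inf m) zstar)
    (zstar_unique : forall z : point m,
       lp_optimal m (sigma_inf m) z -> z = zstar)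
    (sigma_inf_gt0 : ltv 0 (sigma_inf m))
    (zhat : point m)
    (zhat_conv : forall i, convX m i (zhat i))
    (zeta_gt0 : 0 < zeta m zhat)
    (ystar : 'I_N -> 'cV[R]_S)
    (ystar_optimal : master_optimal m (sigma_inf m) ystar)
    (rho_infty xi_infty : 'I_N -> R) (x_infty : point m)
    (x_infty_optimal : forall i,
       lex_optimal m i (ystar i) (rho_infty i) (xi_infty i) (x_infty i)) :
  (#|I_R m zstar| <= S)%N /\
  cost m x_infty - J_milp m <= B' m x_infty zstar zhat.
Proof.
have cX i : compact (Xset m i) by exact: compact_Xset.
split; first exact: (card_I_R zstar_optimal zstar_unique).
have zy := master_optimal_usage (Ordinal N_gt0) cX zstar_optimal zstar_unique
  ystar_optimal.
have integral_part : cost m x_infty - cost m zstar <= \sum_(i in I_R m zstar)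
    (dotp (obj m i) (x_infty i) - dotp (obj m i) (zstar i)).
  rewrite /cost -sumrB (bigID [in I_R m zstar]) /= gerDl; apply: sumr_le0 => i.
  rewrite inE => /asboolPn/contrapT Xz.
  by rewrite subr_le0; exact: (lex_cost_le (x_infty_optimal i) Xz (zy i)).
have restriction_price : cost m zstar - `|sigma_inf m| / zeta m zhat *
    (cost m zhat - cost m zstar) <= J_milp m.
  apply: lb_le_inf => [|_ [x xF <-]].
    by case: milp_is_feasible => x xF; exists (cost m x), x.
  have := slater_bound (Ordinal S_gt0) zstar_optimal zhat_conv zeta_gt0 xF.
  by rewrite lerBlDr -lerBlDl.
rewrite /B'; lra.
Qed.
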